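(* Let $A$ be a finite dimensional local algebra over a field $K$, let $M$ be any finitely generated right $A$-module, and let $\Lambda=A[M]$ be the one-point extension. Then $k\text{-}\operatorname{ddell}\Lambda<\infty$ for every integer $k\ge1$.
   Context: The one-point extension is the matrix algebra $A[M]=\begin{pmatrix}K&M\\0&A\end{pmatrix}$, with $M$ viewed as a $K$-$A$-bimodule; as right modules, its indecomposable projectives are $A$ (annihilated by the new idempotent) and one further projective whose radical is $M$ and whose top is the new simple module. For a finite dimensional algebra $\Lambda$, $\mathrm{mod}\,\Lambda$ is the category of finitely generated right $\Lambda$-modules. $\mathbb N$ is the set of nonnegative integers; the infimum of the empty set is $+\infty$. $\Omega X$ is the kernel of a projective cover of $X$, $\Omega^0X=X$, $\Omega^{n+1}X=\Omega(\Omega^nX)$. ''$U$ is a direct summand of $V$ up to projective summands'' means that $U$ is isomorphic to a direct summand of $V\oplus P$ for some projective $P$. For an integer $j\ge1$, $j\text{-}\operatorname{dell}X$ is the infimum of all $n\in\mathbb N$ such that $\Omega^nX$ is a direct summand of $\Omega^{n+j}N$ up to projective summands for some $N\in\mathrm{mod}\,\Lambda$. $k\text{-}\operatorname{ddell}X$ is the infimum of all $m\in\mathbb N$ for which there exist $0\le n\le m$ and an exact sequence $0\to C_n\to\cdots\to C_1\to C_0\to X\to0$ in $\mathrm{mod}\,\Lambda$ with $(i+k)\text{-}\operatorname{dell}C_i\le m-i$ for $i=0,\dots,n$. $k\text{-}\operatorname{ddell}\Lambda=\sup\{k\text{-}\operatorname{ddell}S\mid S\text{ a simple right }\Lambda\text{-module}\}$.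 *)

(* Defs.v *)
From HB Require Import structures.
From mathcomp Require Import all_boot all_order all_algebra all_field.
From mathcomp Require Import boolp classical_sets.

Set Implicit Arguments.
Unset Strict Implicit.
Unset Printing Implicit Defensive.

Import GRing.Theory.
Local Open Scope ring_scope.
Local Open Scope classical_set_scope.

(* The extended natural numbers; [None] is the value +oo. *)
Definition enat := option nat.

Definition enat_le (e : enat) (n : nat) : bool :=
  if e is Some p then (p <= n)%N else false.

Definition enat_finite (e : enat) : Prop := exists n : nat, e = Some n.

Definition enat_inf (P : set nat) : enat :=
  if pselect (exists n, `[< P n >]) is left exP
  then Some (ex_minn exP) else None.

(* The least upper bound in the extended natural numbers: it is the least
   finite upper bound, and +oo when there is none. *)
Definition enat_sup (E : set enat) : enat :=
  enat_inf [set n | forall e, E e -> enat_le e n].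

(* A right R-module is a left module over the converse ring R^c: the action
   of r on x is written [(r : R^c) *: x]. *)
Definition finitely_generated (R : nzRingType) (X : lmodType R^c) : Prop :=
  exists s : seq X, forall x : X, exists c : 'I_(size s) -> R^c,
    x = \sum_(i < size s) c i *: s`_i.

Record fgMod (R : nzRingType) : Type := FgMod {
  fgMod_sort :> lmodType R^c;
  fgModP : finitely_generated fgMod_sort }.

Section Modules.
Variable R : nzRingType.
Implicit Types X Y U V N : fgMod R.

Definition submodule (V : lmodType R^c) (W : set V) : Prop :=
  W 0 /\ forall (r : R^c) (u v : V), W u -> W v -> W (r *: u + v).

Definition simple_module (V : lmodType R^c) : Prop :=
  (exists v : V, v != 0) /\
  forall W : set V, submodule W -> W = [set 0] \/ W = setT.

Definition surjective (S T : Type) (f : S -> T) : Prop :=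
  forall y, exists x, f x = y.

Definition ker (U V : lmodType R^c) (f : {linear U -> V}) : set U :=
  [set u | f u = 0].

Definition isomorphic (U V : lmodType R^c) : Prop :=
  exists f : {linear U -> V}, bijective f.

Definition projective (P : lmodType R^c) : Prop :=
  forall (U V : lmodType R^c) (g : {linear U -> V}) (f : {linear P -> V}),
    surjective g -> exists h : {linear P -> U}, forall x, g (h x) = f x.

Definition superfluous (V : lmodType R^c) (W : set V) : Prop :=
  forall W' : set V, submodule W' ->
    (forall v, exists w w', [/\ W w, W' w' & v = w + w']) -> W' = setT.

Definition projective_cover (P X : lmodType R^c) (p : {linear P -> X}) : Prop :=
  [/\ projective P, surjective p & superfluous (ker p)].

(* Projective covers being unique up to isomorphism, syzygies are handled as
   relations: [is_Omega X Y] says that Y is (a copy of) Omega X. *)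
Definition is_Omega X Y : Prop :=
  exists (P : fgMod R) (p : {linear P -> X}) (i : {linear Y -> P}),
    [/\ projective_cover p, injective i & range i = ker p].

Fixpoint is_Omega_iter (n : nat) X Y : Prop :=
  if n is n'.+1 then exists2 Z : fgMod R, is_Omega_iter n' X Z & is_Omega Z Y
  else isomorphic X Y.

Definition summand_up_to_projectives U V : Prop :=
  exists P W : fgMod R,
    projective P /\ isomorphic (U * W)%type (V * P)%type.

Definition dell (j : nat) X : enat :=
  enat_inf [set n | exists N U V : fgMod R,
    [/\ is_Omega_iter n X U, is_Omega_iter (n + j) N V
      & summand_up_to_projectives U V]].

(* The sequence 0 -> C_n -> ... -> C_0 -> X -> 0 is prolonged to the left by
   zero modules, so that exactness at C_n (injectivity of its outgoing map) is
   an instance of the general condition. *)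
Definition exact_sequence (n : nat) (C : nat -> fgMod R)
    (d : forall i, {linear C i.+1 -> C i}) X (e : {linear C 0%N -> X}) : Prop :=
  [/\ surjective e,
      range (d 0%N) = ker e,
      forall i, range (d i.+1) = ker (d i)
    & forall i, (n < i)%N -> forall x : C i, x = 0].

Definition ddell (k : nat) X : enat :=
  enat_inf [set m | exists n : nat, (n <= m)%N /\
    exists (C : nat -> fgMod R) (d : forall i, {linear C i.+1 -> C i})
           (e : {linear C 0%N -> X}),
      exact_sequence n d e /\
      forall i, (i <= n)%N -> enat_le (dell (i + k) (C i)) (m - i)].

End Modules.

Definition ddell_ring (k : nat) (R : nzRingType) : enat :=
  enat_sup [set e | exists2 S : fgMod R, simple_module S & e = ddell k S].

Section Local.
Variable R : nzRingType.

Definition right_ideal (I : set R) : Prop :=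
  [/\ I 0, forall x y, I x -> I y -> I (x + y)
    & forall x r, I x -> I (x * r)].

Definition maximal_right_ideal (I : set R) : Prop :=
  [/\ right_ideal I, I <> setT
    & forall J, right_ideal J -> I `<=` J -> J = I \/ J = setT].

Definition local_ring : Prop := exists! I : set R, maximal_right_ideal I.

End Local.

Section OnePointExtension.
Variables (K : fieldType) (A : algType K) (M : lmodType A^c).

(* The triple (c, m, a) stands for the matrix with rows (c m) and (0 a). The
   field K acts on M through the structure map K -> A. *)
Definition one_point_extension : Type := (K * M * A)%type.
Local Notation L := one_point_extension.

HB.instance Definition _ := GRing.Zmodule.on L.

Definition one_point_lact (c : K) (m : M) : M := (c%:A : A^c) *: m.
Definition one_point_ract (m : M) (a : A) : M := (a : A^c) *: m.

Definition one_point_one : L := (1, 0, 1).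
Definition one_point_mul (x y : L) : L :=
  (x.1.1 * y.1.1,
   one_point_lact x.1.1 y.1.2 + one_point_ract x.1.2 y.2,
   x.2 * y.2).
Definition one_point_scale (c : K) (x : L) : L :=
  (c * x.1.1, one_point_lact c x.1.2, c *: x.2).

Let actA m a b : one_point_ract (one_point_ract m a) b = one_point_ract m (a * b).
Proof. by rewrite /one_point_ract scalerA. Qed.
Let scalA c d m : one_point_lact c (one_point_lact d m) = one_point_lact (c * d) m.
Proof.
rewrite /one_point_lact scalerA; congr (_ *: _).
by rewrite -[RHS]/((c * d)%:A) -[LHS]/(d%:A * c%:A : A) -scalerAl mul1r scalerA mulrC.
Qed.
Let scal_act c m a : one_point_lact c (one_point_ract m a) = one_point_ract (one_point_lact c m) a.
Proof.
rewrite /one_point_lact /one_point_ract !scalerA; congr (_ *: _).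
by rewrite -[LHS]/(a * c%:A : A) -[RHS]/(c%:A * a : A) -scalerAl -scalerAr mul1r mulr1.
Qed.
Let act_scal c m a : one_point_ract m (c *: a) = one_point_lact c (one_point_ract m a).
Proof.
rewrite /one_point_lact /one_point_ract scalerA; congr (_ *: _).
by rewrite -[RHS]/(a * c%:A : A) -scalerAr mulr1.
Qed.
Let scalDr c : {morph one_point_lact c : m n / m + n}.
Proof. by move=> m n; rewrite /one_point_lact scalerDr. Qed.
Let scalDl m c d : one_point_lact (c + d) m = one_point_lact c m + one_point_lact d m.
Proof. by rewrite /one_point_lact scalerDl -[RHS]scalerDl. Qed.
Let actDr m a b : one_point_ract m (a + b) = one_point_ract m a + one_point_ract m b.
Proof. by rewrite /one_point_ract -[RHS]scalerDl. Qed.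
Let actDl m n a : one_point_ract (m + n) a = one_point_ract m a + one_point_ract n a.
Proof. by rewrite /one_point_ract scalerDr. Qed.
Let scal1 m : one_point_lact 1 m = m.
Proof. by rewrite /one_point_lact scale1r -[RHS]scale1r. Qed.
Let act1 m : one_point_ract m 1 = m.
Proof. by rewrite /one_point_ract -[RHS]scale1r. Qed.
Let scal0 c : one_point_lact c 0 = 0.
Proof. by rewrite /one_point_lact scaler0. Qed.
Let act0 a : one_point_ract 0 a = 0.
Proof. by rewrite /one_point_ract scaler0. Qed.

Fact one_point_mulA : associative one_point_mul.
Proof.
move=> [[c m] a] [[c' m'] a'] [[c'' m''] a'']; rewrite /one_point_mul /=.
by rewrite !mulrA scalDr actDl scalA scal_act actA addrA.
Qed.
Fact one_point_mul1r : left_id one_point_one one_point_mul.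
Proof.
by move=> [[c m] a]; rewrite /one_point_mul /= !mul1r scal1 act0 addr0.
Qed.
Fact one_point_mulr1 : right_id one_point_one one_point_mul.
Proof.
by move=> [[c m] a]; rewrite /one_point_mul /= !mulr1 act1 scal0 add0r.
Qed.
Fact one_point_mulDl : left_distributive one_point_mul +%R.
Proof.
move=> [[c m] a] [[c' m'] a'] [[c'' m''] a'']; rewrite /one_point_mul /=.
by congr (_, _, _); rewrite /= ?mulrDl // scalDl actDl addrACA.
Qed.
Fact one_point_mulDr : right_distributive one_point_mul +%R.
Proof.
move=> [[c m] a] [[c' m'] a'] [[c'' m''] a'']; rewrite /one_point_mul /=.
by congr (_, _, _); rewrite /= ?mulrDr // scalDr actDr addrACA.
Qed.
Fact one_point_oner_neq0 : one_point_one != 0.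
Proof. by apply/eqP => -[/eqP]; rewrite oner_eq0. Qed.

HB.instance Definition _ := GRing.Zmodule_isNzRing.Build L
  one_point_mulA one_point_mul1r one_point_mulr1
  one_point_mulDl one_point_mulDr one_point_oner_neq0.

Fact one_point_scaleA c d x :
  one_point_scale c (one_point_scale d x) = one_point_scale (c * d) x.
Proof.
by case: x => [[e m] a]; rewrite /one_point_scale /= scalA scalerA mulrA.
Qed.
Fact one_point_scale1 : left_id 1 one_point_scale.
Proof.
by move=> [[e m] a]; rewrite /one_point_scale /= scal1 scale1r mul1r.
Qed.
Fact one_point_scaleDr : right_distributive one_point_scale +%R.
Proof.
move=> c [[e m] a] [[e' m'] a']; rewrite /one_point_scale /=.
by congr (_, _, _); rewrite /= ?mulrDr ?scalDr ?scalerDr.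
Qed.
Fact one_point_scaleDl x : {morph one_point_scale^~ x : c d / c + d}.
Proof.
case: x => [[e m] a] c d; rewrite /one_point_scale /=.
by congr (_, _, _); rewrite /= ?mulrDl ?scalDl ?scalerDl.
Qed.

HB.instance Definition _ := GRing.Zmodule_isLmodule.Build K L
  one_point_scaleA one_point_scale1 one_point_scaleDr one_point_scaleDl.

Fact one_point_scaleAl (c : K) (x y : L) : c *: (x * y) = (c *: x) * y.
Proof.
case: x y => [[e m] a] [[e' m'] a'].
by congr (_, _, _); rewrite /= ?mulrA ?scalerAl // scalDr scalA scal_act.
Qed.
HB.instance Definition _ :=
  GRing.Lmodule_isLalgebra.Build K L one_point_scaleAl.

Fact one_point_scaleAr (c : K) (x y : L) : c *: (x * y) = x * (c *: y).
Proof.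
case: x y => [[e m] a] [[e' m'] a'].
congr (_, _, _); rewrite /=.
- by rewrite mulrCA.
- by rewrite scalDr !scalA mulrC -act_scal.
- by rewrite scalerAr.
Qed.
HB.instance Definition _ :=
  GRing.Lalgebra_isAlgebra.Build K L one_point_scaleAr.

End OnePointExtension.

(* Main.v *)
Require Import Defs.
From HB Require Import structures.
From mathcomp Require Import all_boot all_order all_algebra all_field.
From mathcomp Require Import boolp classical_sets.

(** Over any finite dimensional algebra, the modules of finite k-ddell are
    closed under extensions, and a syzygy of a module of finite k-ddell has
    finite (k+1)-ddell; both follow from the horseshoe construction. Moreover
    every module has finite 0-ddell.

    The simple A-module S of a local algebra A embeds in A, hence is a syzygy
    of an A-module. By induction on k, if all A-modules have finite k-ddell,
    then S has finite (k+1)-ddell, and so does every A-module, being filtered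
    by copies of S. A-modules keep their syzygies when viewed over A[M].

    The other simple A[M]-module is the quotient of A[M] by the right ideal of
    the matrices with zero first diagonal entry. This ideal is an A-module, so
    it has finite (k+1)-ddell, and its quotient has finite k-ddell. *)

Set Implicit Arguments.
Unset Strict Implicit.
Unset Printing Implicit Defensive.

Import GRing.Theory.
Local Open Scope ring_scope.
Local Open Scope classical_set_scope.
Local Open Scope quotient_scope.

(** * Submodules, quotients and linear maps *)

Section Submodule.
Variables (R : nzRingType) (X : lmodType R^c) (W : set X) (hW : submodule W).

Definition submodule_pred of submodule W : {pred X} := fun x => `[< W x >].

Fact submodule_pred_closed : GRing.submod_closed (submodule_pred hW).
Proof.
split; first by apply/asboolP; case: hW.
move=> a u v /asboolP Wu /asboolP Wv.
by apply/asboolP; case: hW => _; apply.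
Qed.

HB.instance Definition _ :=
  GRing.isSubmodClosed.Build R^c X (submodule_pred hW) submodule_pred_closed.

Record submodule_type := SubmoduleType {
  submodule_val : X; _ : submodule_val \in submodule_pred hW }.

HB.instance Definition _ := [isSub for submodule_val].
HB.instance Definition _ := [Choice of submodule_type by <:].
HB.instance Definition _ := [SubChoice_isSubLmodule of submodule_type by <:].

(** This is the quotient of additive groups. The scalar action is put on it below through chosen
    representatives, and [quotient_pi_scale] shows that the choice is harmless. *)
Definition quotient_type := Quotient.quot (submodule_pred hW).
HB.instance Definition _ := GRing.Zmodule.on quotient_type.
HB.instance Definition _ := EqQuotient.on quotient_type.

Definition quotient_proj (x : X) : quotient_type := \pi_quotient_type x.

Definition quotient_scale (a : R^c) (x : quotient_type) : quotient_type :=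
  quotient_proj (a *: repr x).

Lemma quotient_reprK (x : quotient_type) : quotient_proj (repr x) = x.
Proof. exact: reprK. Qed.

Lemma quotient_eqP (x y : X) :
  quotient_proj x = quotient_proj y <-> W (x - y).
Proof.
have E := Quotient.idealrBE (submodule_pred hW) x y.
split=> [/eqP|h]; first by rewrite -E => /asboolP.
by apply/eqP; rewrite -E; apply/asboolP.
Qed.

Lemma quotient_pi_scale (a : R^c) (x : X) :
  quotient_scale a (quotient_proj x) = quotient_proj (a *: x).
Proof.
apply/quotient_eqP; rewrite -scalerBr -[_ *: _]addr0.
case: hW => h0 h; apply: h => //.
by apply/quotient_eqP; rewrite quotient_reprK.
Qed.

Lemma quotient_piD (x y : X) :
  quotient_proj (x + y) = quotient_proj x + quotient_proj y.
Proof. by rewrite -[RHS]pi_addr. Qed.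

Fact quotient_scaleA a b (v : quotient_type) :
  quotient_scale a (quotient_scale b v) = quotient_scale (a * b) v.
Proof. by rewrite -[v]quotient_reprK !quotient_pi_scale scalerA. Qed.
Fact quotient_scale1 : left_id 1 quotient_scale.
Proof. by move=> v; rewrite -[v]quotient_reprK !quotient_pi_scale scale1r. Qed.
Fact quotient_scaleDr : right_distributive quotient_scale +%R.
Proof.
move=> a u v; rewrite -[u]quotient_reprK -[v]quotient_reprK -quotient_piD.
by rewrite !quotient_pi_scale scalerDr quotient_piD.
Qed.
Fact quotient_scaleDl v : {morph quotient_scale^~ v : a b / a + b}.
Proof.
by move=> a b; rewrite -[v]quotient_reprK !quotient_pi_scale scalerDl quotient_piD.
Qed.

HB.instance Definition _ := GRing.Zmodule_isLmodule.Build R^c quotient_type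
  quotient_scaleA quotient_scale1 quotient_scaleDr quotient_scaleDl.

End Submodule.

(** Bundles a function given by a formula; nearly every linear map below is obtained this way. *)
Lemma linear_exists (S : pzRingType) (U V : lmodType S) (f : U -> V) :
  linear f -> exists g : {linear U -> V}, forall x, g x = f x.
Proof.
move=> hf.
pose m := GRing.isLinear.Build S U V *:%R f hf.
pose g : {linear U -> V} := HB.pack f m.
by exists g.
Qed.

Section LinearMaps.
Variable R : nzRingType.
Implicit Types X Y Z U V P Q : lmodType R^c.

Lemma submodule_exists X (W : set X) : submodule W ->
  exists (Y : lmodType R^c) (i : {linear Y -> X}), injective i /\ range i = W.
Proof.
move=> hW; exists (submodule_type hW : lmodType R^c).
have [i iE] := @linear_exists R^c (submodule_type hW) X (@submodule_val _ _ _ hW)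
  (fun a u v => erefl).
exists i; split; first by move=> x y; rewrite !iE => /val_inj.
apply/seteqP; split=> [_ [[x hx] _ <-]|x hx].
  by rewrite iE; apply/asboolP.
have hx' : x \in submodule_pred hW by apply/asboolP.
by exists (SubmoduleType hx') => //; rewrite iE.
Qed.

Lemma quotient_exists X (W : set X) : submodule W ->
  exists (Y : lmodType R^c) (p : {linear X -> Y}), surjective p /\ ker p = W.
Proof.
move=> hW; exists (quotient_type hW : lmodType R^c).
have [p pE] := @linear_exists R^c X (quotient_type hW) (@quotient_proj _ _ _ hW)
  (fun a u v => etrans (quotient_piD hW _ _)
     (congr1 (+%R^~ _) (esym (quotient_pi_scale hW a u)))).
exists p; split=> [y|]; first by exists (repr y); rewrite pE quotient_reprK.
have pi0 : quotient_proj hW 0 = 0 by rewrite -pE linear0.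
apply/seteqP; split=> x; rewrite /ker /= pE -pi0 (quotient_eqP hW) subr0 //.
Qed.

Lemma submodule0 X (W : set X) : submodule W -> W 0. Proof. by case. Qed.
Lemma submoduleD X (W : set X) u v : submodule W -> W u -> W v -> W (u + v).
Proof. by case=> _ h hu hv; rewrite -[u]scale1r; apply: h. Qed.
Lemma submoduleZ X (W : set X) a u : submodule W -> W u -> W (a *: u).
Proof. by case=> h0 h hu; rewrite -[_ *: _]addr0; apply: h. Qed.

Lemma submodule_range X Y (f : {linear X -> Y}) : submodule (range f).
Proof.
split; first by exists 0; rewrite ?linear0.
by move=> r _ _ [u _ <-] [v _ <-]; exists (r *: u + v); rewrite ?linearP.
Qed.

Lemma submodule_ker X Y (f : {linear X -> Y}) : submodule (ker f).
Proof.
split; first exact: linear0.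
by move=> r u v; rewrite /ker /= linearP => -> ->; rewrite scaler0 addr0.
Qed.

Lemma submodule_image X Y (f : {linear X -> Y}) (W : set X) :
  submodule W -> submodule (f @` W).
Proof.
move=> hW; split; first by exists 0; rewrite ?linear0 //; exact: submodule0.
move=> r _ _ [u hu <-] [v hv <-]; exists (r *: u + v); rewrite ?linearP //.
by case: hW => _; apply.
Qed.

Lemma submodule_preimage X Y (f : {linear X -> Y}) (W : set Y) :
  submodule W -> submodule (f @^-1` W).
Proof.
move=> hW; split; first by rewrite /preimage /= linear0; exact: submodule0.
by move=> r u v; rewrite /preimage /= linearP; case: hW => _; apply.
Qed.

Lemma linear_inj0 X Y (f : {linear X -> Y}) :
  (forall x, f x = 0 -> x = 0) -> injective f.
Proof.
move=> h x y e; apply/eqP; rewrite -subr_eq0; apply/eqP/h.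
by rewrite linearB e subrr.
Qed.

(** Preimages are chosen pointwise; injectivity of [i] makes the choice linear. *)
Lemma factor_through_injective X Y Z (i : {linear X -> Y}) (f : {linear Z -> Y}) :
  injective i -> (forall z, range i (f z)) ->
  exists g : {linear Z -> X}, forall z, i (g z) = f z.
Proof.
move=> ii h.
have h' z : exists x, i x = f z by case: (h z) => x _ <-; exists x.
have [g gE] := choice h'.
have [g' g'E] : exists g' : {linear Z -> X}, forall z, g' z = g z.
  by apply: linear_exists => a u v; apply: ii; rewrite linearP !gE linearP.
by exists g' => z; rewrite g'E.
Qed.

(** With a set-theoretic section [s] of [p], the map [f \o s] is linear because [f] is constant on
    the fibres of [p]. *)
Lemma factor_through_surjective X Y Z (p : {linear X -> Y}) (f : {linear X -> Z}) :
  surjective p -> (forall x, p x = 0 -> f x = 0) ->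
  exists g : {linear Y -> Z}, forall x, g (p x) = f x.
Proof.
move=> sp h.
have [s sE] := choice sp.
have fs x : f (s (p x)) = f x.
  apply/eqP; rewrite -subr_eq0 -linearB; apply/eqP/h.
  by rewrite linearB sE subrr.
have [g gE] : exists g : {linear Y -> Z}, forall y, g y = f (s y).
  apply: linear_exists => a u v.
  by rewrite -linearP -[RHS]fs linearP !sE.
by exists g => x; rewrite gE fs.
Qed.

Lemma linear_inverse X Y (f : {linear X -> Y}) : bijective f ->
  exists g : {linear Y -> X}, cancel f g /\ cancel g f.
Proof.
case=> g fK gK.
have [h hE] : exists h : {linear Y -> X}, forall y, h y = g y.
  by apply: linear_exists => a u v; apply: (can_inj fK); rewrite linearP !gK.
by exists h; split=> x; rewrite hE.
Qed.

Lemma bijective_linear X Y (f : {linear X -> Y}) :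
  injective f -> surjective f -> bijective f.
Proof.
move=> fi fs; have [g gE] := choice fs.
by exists g => // x; apply: fi; rewrite gE.
Qed.

Lemma isomorphic_quotients P X Y (p : {linear P -> X}) (q : {linear P -> Y}) :
  surjective p -> surjective q -> ker p = ker q -> isomorphic X Y.
Proof.
move=> sp sq e.
have kE x : p x = 0 <-> q x = 0.
  by rewrite -[p x = 0]/(ker p x) e.
have [g gE] := factor_through_surjective sp (fun x => proj1 (kE x)).
exists g; apply: bijective_linear.
  apply: linear_inj0 => y; have [x <-] := sp y.
  by rewrite gE -kE.
by move=> z; have [x <-] := sq z; exists (p x).
Qed.

Lemma projective_retract P Q (i : {linear Q -> P}) (r : {linear P -> Q}) :
  (forall x, r (i x) = x) -> projective P -> projective Q.
Proof.
move=> ri hP U V g f sg.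
have [h hE] := hP U V g (f \o r)%FUN sg.
by exists (h \o i)%FUN => x; rewrite /= hE /= ri.
Qed.

Lemma projective_prod P Q : projective P -> projective Q ->
  projective (P * Q)%type.
Proof.
move=> hP hQ U V g f sg.
have [i iE] : exists i : {linear P -> (P * Q)%type}, forall x, i x = (x, 0).
  by apply: linear_exists => a u v; congr (_, _); rewrite /= scaler0 addr0.
have [j jE] : exists j : {linear Q -> (P * Q)%type}, forall x, j x = (0, x).
  by apply: linear_exists => a u v; congr (_, _); rewrite /= scaler0 addr0.
have [h1 h1E] := hP U V g (f \o i)%FUN sg.
have [h2 h2E] := hQ U V g (f \o j)%FUN sg.
have [h hE] : exists h : {linear (P * Q)%type -> U},
    forall x, h x = h1 x.1 + h2 x.2.
  by apply: linear_exists => a u v; rewrite !linearP /= scalerDr addrACA.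
exists h => x; rewrite hE linearD h1E h2E /= iE jE -linearD.
by congr (f _); case: x => a b; congr (_, _); rewrite /= ?addr0 ?add0r.
Qed.

Lemma projective_zero X : (forall x : X, x = 0) -> projective X.
Proof.
move=> h U V g f sg.
have [z zE] : exists z : {linear X -> U}, forall x, z x = 0.
  by apply: linear_exists => a u v; rewrite scaler0 addr0.
by exists z => x; rewrite zE (h x) !linear0.
Qed.

Lemma projective_free n : projective 'rV[R^c]_n.
Proof.
move=> U V g f sg.
have [s sE] := choice sg.
have [h hE] : exists h : {linear 'rV[R^c]_n -> U},
    forall v, h v = \sum_i v 0 i *: s (f (delta_mx 0 i)).
  apply: linear_exists => a u v; rewrite scaler_sumr -big_split; apply: eq_bigr.
  by move=> i _; rewrite !mxE scalerDl scalerA.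
exists h => v; rewrite hE linear_sum {2}(row_sum_delta v) linear_sum.
by apply: eq_bigr => i _; rewrite !linearZ sE.
Qed.

Lemma finitely_generatedP X : finitely_generated X <->
  exists n (p : {linear 'rV[R^c]_n -> X}), surjective p.
Proof.
split=> [[s hs]|[n [p sp]]].
  have [p pE] : exists p : {linear 'rV[R^c]_(size s) -> X},
      forall v, p v = \sum_i v 0 i *: s`_i.
    apply: linear_exists => a u v; rewrite scaler_sumr -big_split; apply: eq_bigr.
    by move=> i _; rewrite !mxE scalerDl scalerA.
  exists (size s), p => x; have [c ->] := hs x.
  exists (\row_i c i); rewrite pE; apply: eq_bigr => i _; by rewrite mxE.
pose s := [seq p (delta_mx 0 i) | i : 'I_n].
have ss : size s = n by rewrite size_map size_enum_ord.
exists s => x; have [v <-] := sp x.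
exists (fun i => v 0 (cast_ord ss i)).
rewrite {1}(row_sum_delta v) linear_sum (reindex (cast_ord ss)) /=; last first.
  by exists (cast_ord (esym ss)) => i _; rewrite ?cast_ordK ?cast_ordKV.
apply: eq_bigr => i _; rewrite linearZ; congr (_ *: _).
rewrite (nth_map (cast_ord ss i)) ?size_enum_ord -?ss //.
by have /= -> := nth_ord_enum (cast_ord ss i) (cast_ord ss i).
Qed.

End LinearMaps.

(** * Chain conditions and projective covers *)

Section ChainConditions.
Variable R : nzRingType.
Implicit Types X Y : lmodType R^c.

(** The chain condition in its maximal-element form, the one in which it is applied below; likewise
    for [artinian]. *)
Definition noetherian X : Prop :=
  forall Q : set (set X), Q `<=` @submodule R X -> (exists W, Q W) ->
  exists2 W, Q W & forall W', Q W' -> W `<=` W' -> W' = W.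

Definition artinian X : Prop :=
  forall Q : set (set X), Q `<=` @submodule R X -> (exists W, Q W) ->
  exists2 W, Q W & forall W', Q W' -> W' `<=` W -> W' = W.

Lemma finitely_generated_surj X Y (p : {linear X -> Y}) :
  surjective p -> finitely_generated X -> finitely_generated Y.
Proof.
move=> sp /finitely_generatedP[n [q sq]]; apply/finitely_generatedP.
exists n, (p \o q)%FUN => y.
by have [x <-] := sp y; have [v <-] := sq x; exists v.
Qed.

Lemma finitely_generated_prod X Y : finitely_generated X ->
  finitely_generated Y -> finitely_generated (X * Y)%type.
Proof.
move=> /finitely_generatedP[m [p sp]] /finitely_generatedP[n [q sq]].
apply/finitely_generatedP; exists (m + n)%N.
have [r rE] : exists r : {linear 'rV[R^c]_(m + n) -> (X * Y)%type},
    forall v, r v = (p (lsubmx v), q (rsubmx v)).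
  by apply: linear_exists => a u v; rewrite !linearP.
exists r => -[x y]; have [u <-] := sp x; have [v <-] := sq y.
by exists (row_mx u v); rewrite rE row_mxKl row_mxKr.
Qed.

Lemma finitely_generated_free n : finitely_generated 'rV[R^c]_n.
Proof. by apply/finitely_generatedP; exists n, idfun => x; exists x. Qed.

Definition fg_prod (X Y : fgMod R) : fgMod R :=
  FgMod (finitely_generated_prod (fgModP X) (fgModP Y)).

(** Among the images in [W] of finitely generated modules, a maximal one is all of [W], since any
    [w] in [W] can be added as one more generator. *)
Lemma noetherian_sub_fg X (W : set X) : noetherian X -> submodule W ->
  exists (Y : fgMod R) (i : {linear Y -> X}), injective i /\ range i = W.
Proof.
move=> nX hW.
pose Q := [set W0 : set X | W0 `<=` W /\
  exists (Z : fgMod R) (f : {linear Z -> X}), range f = W0].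
have [] := nX Q.
- by move=> _ [_ [Z [f <-]]]; exact: submodule_range.
- have [z zE] : exists z : {linear 'rV[R^c]_0 -> X}, forall x, z x = 0.
    by apply: linear_exists => a u v; rewrite scaler0 addr0.
  exists (range z); split; first by move=> _ [v _ <-]; rewrite zE; exact: submodule0.
  by exists (FgMod (finitely_generated_free 0)), z.
move=> W0 [W0W [Z [f fE]]] Wmax.
have W0E : W0 = W.
  apply/seteqP; split=> // w hw.
  have [g gE] : exists g : {linear fg_prod Z (FgMod (finitely_generated_free 1)) -> X},
      forall v, g v = f v.1 + v.2 0 0 *: w.
    apply: linear_exists => a u v.
    by rewrite linearP /= !mxE scalerDl scalerDr scalerA addrACA.
  have <- : range g = W0.
    apply: Wmax; first (split;
      last by exists (fg_prod Z (FgMod (finitely_generated_free 1))), g).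
      move=> _ [v _ <-]; rewrite gE; apply: submoduleD => //; last exact: submoduleZ.
      by apply: W0W; rewrite -fE; exists v.1.
    by rewrite -fE => _ [v _ <-]; exists (v, 0) => //; rewrite gE /= mxE scale0r addr0.
  by exists (0, 1) => //; rewrite gE /= linear0 mxE scale1r add0r.
have fW : range f = W by rewrite fE.
have [Y [i [ii iE]]] := submodule_exists hW.
have [g gE] : exists g : {linear Z -> Y}, forall z, i (g z) = f z.
  by apply: factor_through_injective => // z; rewrite iE -fW; exists z.
have fgY : finitely_generated Y.
  apply: (@finitely_generated_surj Z Y g); last exact: fgModP.
  move=> y; have : W (i y) by rewrite -iE; exists y.
  by rewrite -fW => -[z _ ez]; exists z; apply: ii; rewrite gE.
by exists (FgMod fgY), i.
Qed.

End ChainConditions.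

(** * Chain conditions over finite dimensional algebras *)

Section FiniteDimensional.
Variables (K : fieldType) (R : algType K) (V : vectType K).
Variables (sigma : {linear V -> R}) (sigma_surj : surjective sigma).

(** Finite dimension of [R] is expressed by the surjection [sigma] from a vector space. Tuples over
    [V], one entry per generator, then cover [X] compatibly with the action of [K] through [R]. *)
Lemma fin_dim_cover (X : lmodType R^c) : finitely_generated X ->
  exists (F : vectType K) (p : F -> X),
    [/\ surjective p, forall u v, p (u + v) = p u + p v
      & forall a u, p (a *: u) = (a%:A : R^c) *: p u].
Proof.
case=> s hs; exists {ffun 'I_(size s) -> V}.
exists (fun f : {ffun 'I_(size s) -> V} => \sum_i (sigma (f i) : R^c) *: s`_i); split.
- move=> x; have [c ->] := hs x.
  have [t tE] := choice sigma_surj.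
  by exists [ffun i => t (c i)]; apply: eq_bigr => i _; rewrite ffunE tE.
- move=> u v; rewrite -big_split; apply: eq_bigr => i _.
  by rewrite ffunE linearD -[RHS]scalerDl.
move=> a u; rewrite scaler_sumr; apply: eq_bigr => i _.
rewrite ffunE linearZ scalerA; congr (_ *: _).
by rewrite -[RHS]/(sigma (u i) * a%:A : R) -scalerAr mulr1.
Qed.

(** Take a subspace [U] of largest dimension inside the preimage of [W]. For [f] in the preimage, [U
    + <[f]>] still lies inside it, so [f] belongs to [U]. *)
Lemma submodule_vspace (X : lmodType R^c) (F : vectType K) (p : F -> X)
    (W : set X) :
  (forall u v, p (u + v) = p u + p v) ->
  (forall a u, p (a *: u) = (a%:A : R^c) *: p u) ->
  submodule W -> exists U : {vspace F}, forall f, f \in U <-> W (p f).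
Proof.
move=> pD pZ hW.
have p0 : p 0 = 0 by rewrite -(scale0r 0) pZ scale0r scale0r.
pose Q d := `[< exists U : {vspace F},
  (forall f, f \in U -> W (p f)) /\ \dim U = d >].
have exQ : exists d, Q d.
  exists 0%N; apply/asboolP; exists 0%VS; split; last exact: dimv0.
  by move=> f; rewrite memv0 => /eqP ->; rewrite p0; exact: submodule0.
have bQ d : Q d -> (d <= \dim {:F})%N.
  by move=> /asboolP[U [_ <-]]; apply: dimvS; exact: subvf.
case: (ex_maxnP exQ bQ) => d /asboolP[U [hU dU]] dmax.
exists U => f; split=> [|hf]; first exact: hU.
have : Q (\dim (U + <[f]>)).
  apply/asboolP; exists (U + <[f]>)%VS; split=> // f'.
  move=> /memv_addP[u hu [_ /vlineP[a ->] ->]].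
  by rewrite pD pZ; apply: submoduleD => //; [exact: hU|exact: submoduleZ].
move=> /dmax; rewrite -dU => le.
have /eqP -> : U == (U + <[f]>)%VS by rewrite eqEdim addvSl.
by apply: (subvP (addvSr _ _)); exact: memv_line.
Qed.

(** A submodule is determined by its preimage in [F], as [p] is onto. In any nonempty family, a
    preimage of largest or least dimension gives a maximal or minimal member. *)
Lemma fin_dim_chain_conditions (X : lmodType R^c) :
  finitely_generated X -> noetherian X /\ artinian X.
Proof.
move=> /fin_dim_cover[F [p [sp pD pZ]]].
have ex W := submodule_vspace pD pZ (W := W).
have eqW W W' (U U' : {vspace F}) : (forall f, f \in U <-> W (p f)) ->
    (forall f, f \in U' <-> W' (p f)) -> W `<=` W' ->
    (\dim U' <= \dim U)%N -> W = W'.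
  move=> hU hU' sW le.
  have /eqP eU : U == U'.
    by rewrite eqEdim le andbT; apply/subvP => f /hU/sW/hU'.
  by apply/seteqP; split=> // x; have [f <-] := sp x => /hU'; rewrite -eU => /hU.
split=> Q QS [W0 QW0];
  pose D d := `[< exists W (U : {vspace F}),
    [/\ Q W, forall f, f \in U <-> W (p f) & \dim U = d] >].
- have exD : exists d, D d.
    by have [U hU] := ex _ (QS _ QW0); exists (\dim U); apply/asboolP; exists W0, U.
  have bD d : D d -> (d <= \dim {:F})%N.
    by move=> /asboolP[W [U [_ _ <-]]]; apply: dimvS; exact: subvf.
  case: (ex_maxnP exD bD) => d /asboolP[W [U [QW hU dU]]] dmax.
  exists W => // W' QW' sW; have [U' hU'] := ex _ (QS _ QW').
  apply/esym; apply: (eqW _ _ U U') => //; rewrite dU; apply: dmax.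
  by apply/asboolP; exists W', U'.
- have exD : exists d, D d.
    by have [U hU] := ex _ (QS _ QW0); exists (\dim U); apply/asboolP; exists W0, U.
  case: (ex_minnP exD) => d /asboolP[W [U [QW hU dU]]] dmin.
  exists W => // W' QW' sW; have [U' hU'] := ex _ (QS _ QW').
  apply: (eqW _ _ U' U) => //; rewrite dU; apply: dmin.
  by apply/asboolP; exists W', U'.
Qed.

End FiniteDimensional.

(** * Rings over which finitely generated modules have finite length *)

Definition finite_length_ring (R : nzRingType) : Prop :=
  forall X : fgMod R, noetherian X /\ artinian X.

Section FiniteLength.
Variable R : nzRingType.
Hypothesis hR : finite_length_ring R.
Implicit Types X Y P : fgMod R.

Lemma fg_submodule X (W : set X) : submodule W ->
  exists (Y : fgMod R) (i : {linear Y -> X}), injective i /\ range i = W.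
Proof. by apply: noetherian_sub_fg; case: (hR X). Qed.

Lemma fg_quotient X (W : set X) : submodule W ->
  exists (Y : fgMod R) (p : {linear X -> Y}), surjective p /\ ker p = W.
Proof.
move=> /quotient_exists[Y [p [sp kp]]].
have fgY := finitely_generated_surj sp (fgModP X).
by exists (FgMod fgY), p.
Qed.

Lemma fg_projective_surj X :
  exists (P : fgMod R) (p : {linear P -> X}), projective P /\ surjective p.
Proof.
have [n [p sp]] := iffLR (finitely_generatedP X) (fgModP X).
exists (FgMod (finitely_generated_free R n)), p; split=> //.
exact: projective_free.
Qed.

(* An endomorphism e of a projective P over X whose image is minimal splits
   its image off P, and the image is then a projective cover of X. *)
Lemma projective_cover_exists X :
  exists (P : fgMod R) (p : {linear P -> X}), projective_cover p.
Proof.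
have [P [p [pP sp]]] := fg_projective_surj X.
have [nP aP] := hR P.
pose Q := [set W : set P | exists e : {linear P -> P},
  (forall x, p (e x) = p x) /\ range e = W].
have [||W [e [pe eW]] Wmin] := aP Q.
- by move=> _ [e [_ <-]]; exact: submodule_range.
- by exists (range (idfun : {linear P -> P})), idfun.
(* The map [e \o e] also lies over [X] and has its image inside [W]; by minimality [e] maps [W] onto
   itself. *)
have ee x : exists y, e (e y) = e x.
  have : range (e \o e)%FUN = W.
    apply: Wmin; first by exists (e \o e)%FUN; split=> // y; rewrite /= !pe.
    by rewrite -eW => _ [y _ <-]; exists (e y).
  rewrite -eW => E; have : range e (e x) by exists x.
  by rewrite -E => -[y _ <-]; exists y.
have eit n x : exists y, iter n e (e y) = e x.
  elim: n => [|n [y <-]]; first by exists x.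
  by have [z <-] := ee y; exists z; rewrite iterSr.
have itP n : linear (iter n e).
  by elim: n => [|n IH] a u v //=; rewrite IH linearP.
(* Fitting's argument: the kernels of the iterates of [e] stabilise at some [n], and [e x] is the
   value of the [n]-th iterate at some [e y]. Hence [e] is injective on its image. *)
have e_inj x : e (e x) = 0 -> e x = 0.
  move=> e0.
  pose Q' := [set W : set P | exists n, W = [set y | iter n e y = 0]].
  have [||_ [n ->] nmax] := nP Q'.
  - move=> _ [n ->]; have [g gE] := linear_exists (itP n).
    have -> : [set y | iter n e y = 0] = ker g; last exact: submodule_ker.
    by apply/seteqP; split=> y; rewrite /ker /= gE.
  - by exists [set y | iter 0 e y = 0]; exists 0%N.
  have nE : [set y | iter n.+1 e y = 0] = [set y | iter n e y = 0].
    apply: nmax; first by exists n.+1.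
    by move=> y /= ->; rewrite linear0.
  have [y ey] := eit n x; rewrite -ey in e0 *.
  by have : [set y | iter n.+1 e y = 0] (e y) by []; rewrite nE.
have [Y [i [ii iE]]] := fg_submodule (submodule_range e).
have [e' e'E] : exists e' : {linear P -> Y}, forall x, i (e' x) = e x.
  by apply: factor_through_injective => // x; rewrite iE; exists x.
have ie y : exists x, i y = e x.
  have : range i (i y) by exists y.
  by rewrite iE => -[x _ <-]; exists x.
have e'i_inj : injective (e' \o i)%FUN.
  apply: linear_inj0 => y; rewrite /= => /(congr1 i); rewrite e'E linear0.
  by have [x yx] := ie y; rewrite yx => /e_inj; rewrite -yx -(linear0 i) => /ii.
have e'i_surj : surjective (e' \o i)%FUN.
  move=> y; have [x yx] := ie y; have [z zx] := ee x.
  by exists (e' z); apply: ii; rewrite /= !e'E zx.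
(* Now [e] is bijective on its image [Y], so [g \o e'] retracts [P] onto [Y], and [Y] is
   projective. *)
have [g [gK Kg]] := linear_inverse (bijective_linear e'i_inj e'i_surj).
have pi_surj : surjective (p \o i)%FUN.
  move=> x; have [u <-] := sp x; have : range e (e u) by exists u.
  by rewrite -iE => -[y _ yu]; exists y; rewrite /= yu pe.
exists Y, (p \o i)%FUN; split=> //.
  exact: (@projective_retract _ P Y i (g \o e')%FUN gK pP).
move=> W' sW' hW'.
have [Z [j [ji jE]]] := fg_submodule sW'.
have pij_surj : surjective (p \o (i \o j))%FUN.
  move=> x; have [y <-] := pi_surj x; have [w [w' [kw hw' ->]]] := hW' y.
  move: hw'; rewrite -jE => -[z _ <-]; exists z.
  by rewrite linearD -[X in X + _]/((p \o i)%FUN w) kw add0r.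
have [h hE] := pP _ _ (p \o (i \o j))%FUN p pij_surj.
have rE : range (i \o (j \o h))%FUN = W.
  apply: Wmin; first by exists (i \o (j \o h))%FUN; split=> // x; exact: hE.
  by rewrite -eW -iE => _ [x _ <-]; exists (j (h x)).
apply/seteqP; split=> // y _.
have : W (i y) by rewrite -eW -iE; exists y.
by rewrite -rE -jE => -[x _ /ii <-]; exists (h x).
Qed.

End FiniteLength.

(** * Syzygies and finite delooping levels *)

Section Syzygies.
Variable R : nzRingType.
Implicit Types X Y Z U V N P Q C : fgMod R.

Definition short_exact X Y Z (i : {linear X -> Y}) (p : {linear Y -> Z}) : Prop :=
  [/\ injective i, surjective p & range i = ker p].

Lemma short_exact_comp0 X Y Z (i : {linear X -> Y}) (p : {linear Y -> Z}) :
  short_exact i p -> forall x, p (i x) = 0.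
Proof.
case=> _ _ e x; have : range i (i x) by exists x.
by rewrite e.
Qed.

Lemma short_exact_lift X Y Z (i : {linear X -> Y}) (p : {linear Y -> Z}) :
  short_exact i p -> forall y, p y = 0 -> exists x, i x = y.
Proof.
case=> _ _ e y hy; have : ker p y by [].
by rewrite -e => -[x _ <-]; exists x.
Qed.

Lemma short_exactI X Y Z (i : {linear X -> Y}) (p : {linear Y -> Z}) :
  injective i -> surjective p -> (forall x, p (i x) = 0) ->
  (forall y, p y = 0 -> exists x, i x = y) -> short_exact i p.
Proof.
move=> ii sp h0 h; split=> //; apply/seteqP; split=> [_ [x _ <-]|y /h[x <-]].
  exact: h0.
by exists x.
Qed.

Lemma short_exact_factor X Y Z U (i : {linear X -> Y}) (p : {linear Y -> Z})
    (f : {linear U -> Y}) :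
  short_exact i p -> (forall u, p (f u) = 0) ->
  exists g : {linear U -> X}, forall u, i (g u) = f u.
Proof.
move=> se h; apply: factor_through_injective; first by case: se.
by move=> u; have [x xE] := short_exact_lift se (h u); exists x.
Qed.

(** The kernel of any surjection from a projective module, minimal or not; [is_Omega] is the minimal
    case. *)
Definition syzygy X Y : Prop :=
  exists (P : fgMod R) (i : {linear Y -> P}) (p : {linear P -> X}),
    projective P /\ short_exact i p.

Fixpoint iter_syzygy n X Y : Prop :=
  if n is n'.+1 then exists2 Z, iter_syzygy n' X Z & syzygy Z Y
  else isomorphic X Y.

Lemma is_Omega_syzygy X Y : is_Omega X Y -> syzygy X Y.
Proof. by case=> P [p [i [[pP sp _] ii e]]]; exists P, i, p. Qed.

Lemma is_Omega_iter_syzygy n X Y : is_Omega_iter n X Y -> iter_syzygy n X Y.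
Proof.
elim: n Y => [//|n IH] Y [Z hZ ZY]; exists Z; first exact: IH.
exact: is_Omega_syzygy.
Qed.

Lemma isomorphic_refl (X : lmodType R^c) : isomorphic X X.
Proof. by exists idfun; exists idfun. Qed.

Lemma syzygy_isomorphic X Y Y' : syzygy X Y -> isomorphic Y Y' -> syzygy X Y'.
Proof.
case=> P [i [p [pP [ii sp e]]]] [f /linear_inverse[g [fK gK]]].
exists P, (i \o g)%FUN, p; split=> //; split=> //.
  exact: inj_comp ii (can_inj gK).
rewrite -e; apply/seteqP; split=> _ [y _ <-]; first by exists (g y).
by exists (f y) => //=; rewrite fK.
Qed.

(** [iter_syzygy] recurses on the last syzygy taken; this prepends one at the start. *)
Lemma iter_syzygySl n X Y Z : syzygy X Y -> iter_syzygy n Y Z ->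
  iter_syzygy n.+1 X Z.
Proof.
move=> XY; elim: n Z => [|n IH] Z.
  by move=> YZ; exists X; [exact: isomorphic_refl|exact: syzygy_isomorphic XY YZ].
by case=> Z' /IH h h'; exists Z'.
Qed.

(* U is a direct summand of V + Q with Q projective: the identity of U is
   the sum of a map factoring through V and one factoring through Q. *)
Definition stable_retract U V : Prop :=
  exists (Q : fgMod R) (f : {linear U -> V}) (g : {linear V -> U})
         (a : {linear U -> Q}) (b : {linear Q -> U}),
    projective Q /\ forall u, u = g (f u) + b (a u).

Lemma isomorphic_stable_retract U V : isomorphic U V -> stable_retract U V.
Proof.
case=> f /linear_inverse[g [fK gK]].
exists (FgMod (finitely_generated_free R 0)), f, g, \0, \0; split.
  exact: projective_free.
by move=> u; rewrite fK addr0.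
Qed.

Lemma projective_stable_retract P V : projective P -> stable_retract P V.
Proof.
by move=> pP; exists P, \0, \0, idfun, idfun; split=> // u; rewrite add0r.
Qed.

Lemma stable_retract_trans V U W :
  stable_retract U V -> stable_retract V W -> stable_retract U W.
Proof.
case=> Q [f [g [a [b [pQ h]]]]] [Q' [f' [g' [a' [b' [pQ' h']]]]]].
have [s sE] : exists s : {linear U -> fg_prod Q Q'},
    forall u, s u = (a u, a' (f u)).
  by apply: linear_exists => c u v; rewrite !linearP.
have [r rE] : exists r : {linear fg_prod Q Q' -> U},
    forall u, r u = b u.1 + g (b' u.2).
  by apply: linear_exists => c u v; rewrite !linearP /= scalerDr addrACA.
exists (fg_prod Q Q'), (f' \o f)%FUN, (g \o g')%FUN, s, r; split.
  exact: projective_prod.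
by move=> u; rewrite sE rE /= addrCA -linearD -h' addrC.
Qed.

(** Lift [f], [g], [b] to [F], [G], [B] on the presentations and restrict [F], [G] to the syzygies.
    The error [d] is killed by [p], so it factors through [U'] by a map [k]. On [U'] the term with
    [B] vanishes, and the identity is [g' \o f'] plus [k \o i], which factors through [P]. *)
Lemma stable_retract_syzygy U V U' V' : stable_retract U V ->
  syzygy U U' -> syzygy V V' -> stable_retract U' V'.
Proof.
case=> Q [f [g [a [b [pQ h]]]]] [P [i [p [pP se]]]] [P' [i' [p' [pP' se']]]].
have [_ sp _] := se; have [_ sp' _] := se'.
have [F FE] := pP _ _ p' (f \o p)%FUN sp'.
have [G GE] := pP' _ _ p (g \o p')%FUN sp.
have [B BE] := pQ _ _ p b sp.
have [f' f'E] : exists f' : {linear U' -> V'}, forall u, i' (f' u) = (F \o i)%FUN u.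
  by apply: short_exact_factor se' _ => u; rewrite /= FE /= (short_exact_comp0 se) linear0.
have [g' g'E] : exists g' : {linear V' -> U'}, forall u, i (g' u) = (G \o i')%FUN u.
  by apply: short_exact_factor se _ => u; rewrite /= GE /= (short_exact_comp0 se') linear0.
have [d dE] : exists d : {linear P -> P},
    forall x, d x = x - G (F x) - B (a (p x)).
  by exists (idfun \- (G \o F)%FUN \- (B \o (a \o p))%FUN).
have [k kE] : exists k : {linear P -> U'}, forall x, i (k x) = d x.
  apply: short_exact_factor se _ => x.
  by rewrite dE !linearB GE /= FE BE /= {1}(h (p x)) addrAC addrK subrr.
exists P, f', g', i, k; split=> // u.
have [ii _ _] := se; apply: ii.
rewrite linearD g'E /= f'E /= kE dE (short_exact_comp0 se) !linear0 addr0.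
by rewrite addrC subrK.
Qed.

Lemma stable_retract_iter_syzygy n U V U' V' : stable_retract U V ->
  iter_syzygy n U U' -> iter_syzygy n V V' -> stable_retract U' V'.
Proof.
move=> UV; elim: n U' V' => [|n IH] U' V'.
  move=> [f fb] VV'; have [g [fK gK]] := linear_inverse fb.
  have U'U : isomorphic U' U by exists g; exists f.
  apply: stable_retract_trans (isomorphic_stable_retract VV').
  exact: stable_retract_trans (isomorphic_stable_retract U'U) UV.
move=> [Z UZ ZU'] [Z' VZ' ZV']; apply: stable_retract_syzygy ZU' ZV'.
exact: IH UZ VZ'.
Qed.

(* Arbitrary projective presentations are allowed in place of minimal ones;
   the universal quantifier makes the choice of syzygies irrelevant. *)
Definition finite_dell k C : Prop :=
  exists n N, forall U V, iter_syzygy n C U -> iter_syzygy (n + k) N V ->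
    stable_retract U V.

Lemma finite_dell0 C : finite_dell 0 C.
Proof.
exists 0%N, C => U V CU CV.
apply: (@stable_retract_iter_syzygy 0 C C) => //.
exact/isomorphic_stable_retract/isomorphic_refl.
Qed.

Lemma finite_dell_projective k P : projective P -> finite_dell k P.
Proof.
move=> pP; exists 0%N, P => U V [f fb] _.
apply: projective_stable_retract; have [g [fK gK]] := linear_inverse fb.
exact: projective_retract gK pP.
Qed.

(** The same [n] and [N] serve: an [n]-th syzygy of [H] is a syzygy of an [n]-th syzygy of [C], and
    taking a syzygy preserves stable retracts. *)
Lemma finite_dell_syzygy k C H :
  finite_dell k C -> syzygy C H -> finite_dell k.+1 H.
Proof.
case=> n [N h] CH; exists n, N => U V HU.
rewrite addnS => -[V0 NV0 V0V].
have [U0 CU0 U0U] := iter_syzygySl CH HU.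
exact: stable_retract_syzygy (h _ _ CU0 NV0) U0U V0V.
Qed.

Hypothesis hR : finite_length_ring R.

Lemma fg_kernel X Y (p : {linear X -> Y}) : surjective p ->
  exists (Z : fgMod R) (i : {linear Z -> X}), short_exact i p.
Proof.
move=> sp; have [Z [i [ii e]]] := fg_submodule hR (submodule_ker p).
by exists Z, i.
Qed.

Lemma is_Omega_exists X : exists Y, is_Omega X Y.
Proof.
have [P [p pc]] := projective_cover_exists hR X.
have [_ sp _] := pc; have [Y [i [ii _ e]]] := fg_kernel sp.
by exists Y, P, p, i.
Qed.

Lemma is_Omega_iter_exists n X : exists Y, is_Omega_iter n X Y.
Proof.
elim: n => [|n [Z hZ]]; first by exists X; exact: isomorphic_refl.
by have [Y hY] := is_Omega_exists Z; exists Y, Z.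
Qed.

(** The sum is a stable retract of [C], so its syzygies are stable retracts of those of [C], and [n]
    and [N] carry over. *)
Lemma finite_dell_add_projective k C P :
  projective P -> finite_dell k C -> finite_dell k (fg_prod C P).
Proof.
move=> pP [n [N h]]; exists n, N => U V CU NV.
have [U0 /is_Omega_iter_syzygy CU0] := is_Omega_iter_exists n C.
apply: stable_retract_trans (h _ _ CU0 NV).
apply: stable_retract_iter_syzygy CU CU0.
have [f fE] : exists f : {linear fg_prod C P -> C}, forall x, f x = x.1.
  exact: linear_exists.
have [g gE] : exists g : {linear C -> fg_prod C P}, forall x, g x = (x, 0).
  by apply: linear_exists => a u v; congr (_, _); rewrite /= scaler0 addr0.
have [a aE] : exists a : {linear fg_prod C P -> P}, forall x, a x = x.2.
  exact: linear_exists.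
have [b bE] : exists b : {linear P -> fg_prod C P}, forall x, b x = (0, x).
  by apply: linear_exists => c u v; congr (_, _); rewrite /= scaler0 addr0.
exists P, f, g, a, b; split=> // -[c x]; rewrite fE gE aE bE /=.
by congr (_, _); rewrite /= ?addr0 ?add0r.
Qed.

(** The pair [(f, a)] embeds [U] in [V * Q], split by [g] and [b] together; the kernel of the
    splitting is a complement. *)
Lemma stable_retract_summand U V :
  stable_retract U V -> summand_up_to_projectives U V.
Proof.
case=> Q [f [g [a [b [pQ h]]]]].
have [s sE] : exists s : {linear U -> fg_prod V Q}, forall u, s u = (f u, a u).
  by apply: linear_exists => c u v; rewrite !linearP.
have [r rE] : exists r : {linear fg_prod V Q -> U},
    forall u, r u = g u.1 + b u.2.
  by apply: linear_exists => c u v; rewrite !linearP /= scalerDr addrACA.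
have rs u : r (s u) = u by rewrite rE sE /= -h.
have sr : surjective r by move=> u; exists (s u).
have [W [i se]] := fg_kernel sr; have [ii _ _] := se.
exists Q, W; split=> //.
have [t tE] : exists t : {linear fg_prod U W -> fg_prod V Q},
    forall x, t x = s x.1 + i x.2.
  by apply: linear_exists => c u v; rewrite !linearP /= scalerDr addrACA.
exists t; apply: bijective_linear.
  apply: linear_inj0 => -[u w]; rewrite tE /= => e.
  have := congr1 r e; rewrite linearD rs (short_exact_comp0 se) addr0 linear0.
  move=> u0; move: e; rewrite u0 linear0 add0r -(linear0 i) => /ii ->.
  by [].
move=> x; have e0 : r (x - s (r x)) = 0 by rewrite linearB rs subrr.
have [w wE] := short_exact_lift se e0.
by exists (r x, w); rewrite tE /= wE addrC subrK.
Qed.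

Lemma enat_le_inf (S : set nat) n : S n -> enat_le (enat_inf S) n.
Proof.
move=> Sn; rewrite /enat_inf; case: pselect => [e|[]]; last
  by exists n; apply/asboolP.
by case: ex_minnP => m _ /= h; apply: h; apply/asboolP.
Qed.

Lemma enat_le_trans e m n : enat_le e m -> (m <= n)%N -> enat_le e n.
Proof. by case: e => //= p; exact: leq_trans. Qed.

Lemma finite_dellP k C : finite_dell k C -> exists n, enat_le (dell k C) n.
Proof.
case=> n [N h]; exists n; apply: enat_le_inf.
have [U CU] := is_Omega_iter_exists n C.
have [V NV] := is_Omega_iter_exists (n + k) N.
exists N, U, V; split=> //; apply: stable_retract_summand.
by apply: h; exact: is_Omega_iter_syzygy.
Qed.

(* The k-ddell of X is finite: splitting the resolution of X by the C_i into
   short exact sequences raises k by one at each step. *)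
Inductive finite_ddell : nat -> fgMod R -> Prop :=
| FiniteDdell0 k X : (forall x : X, x = 0) -> finite_ddell k X
| FiniteDdellS k X C Y (i : {linear Y -> C}) (p : {linear C -> X}) :
    short_exact i p -> finite_dell k C -> finite_ddell k.+1 Y ->
    finite_ddell k X.

Lemma finite_ddell_isomorphic k X Y :
  isomorphic X Y -> finite_ddell k X -> finite_ddell k Y.
Proof.
case=> f /linear_inverse[g [fK gK]] h.
case: h f g fK gK => {k X} [k X X0|k X C Z i p [ii sp e] dC GZ] f g fK gK.
  by apply: FiniteDdell0 => y; rewrite -[y]gK (X0 (g y)) linear0.
apply: (FiniteDdellS (i := i) (p := (f \o p)%FUN)) dC GZ; split=> //.
  by move=> y; have [c cE] := sp (g y); exists c; rewrite /= cE gK.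
rewrite e; apply/seteqP; split=> c; rewrite /ker /=; first
  by move=> ->; rewrite linear0.
by rewrite -(linear0 f) => /(can_inj fK).
Qed.

Lemma finite_ddell_finite_dell k X : finite_dell k X -> finite_ddell k X.
Proof.
have sid : surjective (idfun : {linear X -> X}) by move=> x; exists x.
have [Z [i se]] := fg_kernel sid.
move=> dX; apply: (FiniteDdellS se dX); apply: FiniteDdell0 => z.
by have [ii _ _] := se; apply: ii; rewrite linear0; exact: short_exact_comp0 se z.
Qed.

Lemma finite_ddell0 X : finite_ddell 0 X.
Proof. exact/finite_ddell_finite_dell/finite_dell0. Qed.

(** Projectivity of [P] lifts [q] to [l : P -> Y], so [C * P] covers [Y], and its kernel [W] is an
    extension of [Z1] by [X1]. The cover [C] of [X] is arbitrary, as the terms in the definition of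
    [finite_ddell] are. *)
Lemma horseshoe X Y Z X1 C Z1 P (i : {linear X -> Y}) (p : {linear Y -> Z})
    (a : {linear X1 -> C}) (b : {linear C -> X})
    (z : {linear Z1 -> P}) (q : {linear P -> Z}) :
  short_exact i p -> short_exact a b -> short_exact z q -> projective P ->
  exists (W : fgMod R) (w : {linear W -> fg_prod C P})
         (t : {linear fg_prod C P -> Y}) (h : {linear X1 -> W})
         (g : {linear W -> Z1}),
    short_exact w t /\ short_exact h g.
Proof.
move=> se seC seZ pP.
have [ii sp _] := se; have [ai sb _] := seC; have [zi sq _] := seZ.
have [l lE] := pP _ _ p q sp.
have [t tE] : exists t : {linear fg_prod C P -> Y}, forall x, t x = i (b x.1) + l x.2.
  by apply: linear_exists => c u v; rewrite !linearP /= scalerDr addrACA.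
have st : surjective t.
  move=> y; have [x xE] := sq (p y).
  have e0 : p (y - l x) = 0 by rewrite linearB lE xE subrr.
  have [x' x'E] := short_exact_lift se e0; have [u uE] := sb x'.
  by exists (u, x); rewrite tE /= uE x'E subrK.
have [W [w seW]] := fg_kernel st; have [wi _ _] := seW.
have tw x : i (b (w x).1) + l (w x).2 = 0 by rewrite -tE (short_exact_comp0 seW).
have [pr2 pr2E] : exists f : {linear fg_prod C P -> P}, forall x, f x = x.2.
  exact: linear_exists.
have [in1 in1E] : exists f : {linear C -> fg_prod C P}, forall x, f x = (x, 0).
  by apply: linear_exists => c u v; congr (_, _); rewrite /= scaler0 addr0.
have [g gE] : exists g : {linear W -> Z1}, forall x, z (g x) = (pr2 \o w)%FUN x.
  apply: short_exact_factor seZ _ => x /=; rewrite pr2E -lE.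
  by have := congr1 p (tw x); rewrite linearD (short_exact_comp0 se) add0r linear0.
have [h hE] : exists h : {linear X1 -> W}, forall x, w (h x) = (in1 \o a)%FUN x.
  apply: short_exact_factor seW _ => x /=.
  by rewrite tE in1E /= (short_exact_comp0 seC) !linear0 addr0.
exists W, w, t, h, g; split=> //; apply: short_exactI.
- apply: linear_inj0 => x hx; apply: ai; have := hE x.
  by rewrite hx !linear0 /= in1E => -[<-].
- move=> y; have e0 : p (- l (z y)) = 0.
    by rewrite linearN lE (short_exact_comp0 seZ) oppr0.
  have [x' x'E] := short_exact_lift se e0; have [u uE] := sb x'.
  have t0 : t (u, z y) = 0 by rewrite tE /= uE x'E addNr.
  have [x xE] := short_exact_lift seW t0.
  by exists x; apply: zi; rewrite gE /= pr2E xE.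
- by move=> x; apply: zi; rewrite gE /= hE /= pr2E in1E linear0.
move=> x gx.
have w2 : (w x).2 = 0 by rewrite -pr2E -[LHS](gE x) gx linear0.
have b0 : b (w x).1 = 0.
  by apply: ii; have := tw x; rewrite w2 !linear0 addr0.
have [y yE] := short_exact_lift seC b0.
exists y; apply: wi; rewrite hE /= in1E yE -w2.
by case: (w x).
Qed.

(** Induction on the resolution of [X]. A syzygy of zero is projective. Otherwise the horseshoe on
    [X' -> C -> X] gives a syzygy [H] of [C] that maps onto [Y] with kernel a syzygy [Z] of [X'].
    Then [H] has finite [k.+1]-dell, and the induction hypothesis applies to [Z]. *)
Lemma finite_ddell_syzygy k X Y :
  finite_ddell k X -> syzygy X Y -> finite_ddell k.+1 Y.
Proof.
move=> GX; elim: GX Y => {k X} [k X X0|k X C X' i p se dC _ IH] Y.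
  move=> [P [j [q [pP se]]]].
  have jb : bijective j.
    apply: bijective_linear; first by case: se.
    by move=> x; apply: (short_exact_lift se); exact: X0.
  have [g [jK gK]] := linear_inverse jb.
  apply/finite_ddell_finite_dell/finite_dell_projective.
  exact: projective_retract jK pP.
move=> [P [j [q [pP seY]]]].
have [Q [r [pQ sr]]] := fg_projective_surj X'.
have [Z [z seZ]] := fg_kernel sr.
have [H [h [t [a [b [seH seab]]]]]] := horseshoe se seZ seY pP.
apply: (FiniteDdellS seab); last by apply: IH; exists Q, z, r.
apply: finite_dell_syzygy dC _; exists (fg_prod Q P), h, t; split=> //.
exact: projective_prod.
Qed.

End Syzygies.

(** * Extensions, composition factors and bounds on ddell *)

Section Extensions.
Variable R : nzRingType.
Implicit Types X Y Z U V N P Q C T : fgMod R.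
Hypothesis hR : finite_length_ring R.

(** Induction on the resolution of [X]. By the horseshoe, [C * P] covers [Y] with kernel an
    extension of [Z1] by [X1]; here [Z1] is a syzygy of [Z], so both ends have finite
    [k.+1]-ddell. *)
Lemma finite_ddell_extension k X Y Z (i : {linear X -> Y}) (p : {linear Y -> Z}) :
  short_exact i p -> finite_ddell k X -> finite_ddell k Z -> finite_ddell k Y.
Proof.
move=> se GX; elim: GX Y Z i p se => {k X} [k X X0|k X C X1 a b seC dC _ IH];
  move=> Y Z i p se GZ.
  apply: finite_ddell_isomorphic GZ.
  have pb : bijective p.
    apply: bijective_linear; last by case: se.
    apply: linear_inj0 => y /(short_exact_lift se)[x <-].
    by rewrite (X0 x) linear0.
  by have [g [pK gK]] := linear_inverse pb; exists g; exists p.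
have [P [q [pP sq]]] := fg_projective_surj Z.
have [Z1 [z seZ]] := fg_kernel hR sq.
have GZ1 : finite_ddell k.+1 Z1.
  by apply: finite_ddell_syzygy GZ _ => //; exists P, z, q.
have [W [w [t [h [g [seW sehg]]]]]] := horseshoe hR se seC seZ pP.
have GW := IH _ _ h g sehg GZ1.
exact: FiniteDdellS seW (finite_dell_add_projective hR pP dC) GW.
Qed.

Lemma simple_submodule_exists X : (exists x : X, x != 0) ->
  exists (T : fgMod R) (t : {linear T -> X}), injective t /\ simple_module T.
Proof.
case=> x x0; have [_ aX] := hR X.
pose Q := [set W : set X | submodule W /\ exists2 w, W w & w != 0].
have [||W [sW [w Ww w0]] Wmin] := aX Q.
- by move=> W [].
- by exists setT; split; [|exists x].
have [T [t [ti tE]]] := fg_submodule hR sW.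
exists T, t; split=> //; split.
  move: Ww; rewrite -tE => -[v _ vw]; exists v; apply: contra_neq w0 => v0.
  by rewrite -vw v0 linear0.
move=> W' sW'; have [[w' W'w' w'0]|h] :=
  pselect (exists2 w, W' w & w != 0); last first.
  left; apply/seteqP; split=> [y W'y|_ ->]; last exact: submodule0.
  by apply: contrapT => /eqP y0; apply: h; exists y.
right; apply/seteqP; split=> // y _.
have e : t @` W' = W.
  apply: Wmin; last by rewrite -tE => _ [v _ <-]; exists v.
  split; first exact: submodule_image.
  exists (t w'); first by exists w'.
  by apply: contra_neq w'0 => tw'; apply: ti; rewrite tw' linear0.
have : W (t y) by rewrite -tE; exists y.
by rewrite -e => -[v W'v /ti <-].
Qed.

(** A maximal submodule of finite [k]-ddell is all of [X]: otherwise it could be extended by a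
    simple submodule of the quotient. The simple modules are taken inside quotients of [X], so that
    properties inherited by submodules and quotients pass to them. *)
Lemma finite_ddell_composition k X :
  (forall Z T (q : {linear X -> Z}) (t : {linear T -> Z}),
     surjective q -> injective t -> simple_module T -> finite_ddell k T) ->
  finite_ddell k X.
Proof.
move=> hT; have [nX _] := hR X.
pose Q := [set W : set X | exists (Y : fgMod R) (i : {linear Y -> X}),
  [/\ injective i, range i = W & finite_ddell k Y]].
have [||W [Y [i [ii iE GY]]] Wmax] := nX Q.
- by move=> _ [Y [i [_ <- _]]]; exact: submodule_range.
- have s0 : submodule [set 0 : X].
    by split=> // r u v /= -> ->; rewrite scaler0 addr0.
  have [Y [i [ii iE]]] := fg_submodule hR s0.
  exists [set 0], Y, i; split=> //; apply: FiniteDdell0 => y; apply: ii.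
  by rewrite linear0; have : range i (i y) by [exists y]; rewrite iE.
have sW : submodule W by rewrite -iE; exact: submodule_range.
have [Z [q [sq qE]]] := fg_quotient sW.
have [/simple_submodule_exists[T [t [ti sT]]]|h] :=
  pselect (exists z : Z, z != 0); last first.
  have isurj : surjective i.
    move=> x; have : ker q x by apply: contrapT => /eqP qx; apply: h; exists (q x).
    by rewrite qE -iE => -[y _ <-]; exists y.
  by apply: finite_ddell_isomorphic GY; exists i; exact: bijective_linear.
have [Y' [i' [ii' iE']]] := fg_submodule hR (submodule_preimage q (submodule_range t)).
have [a aE] : exists a : {linear Y -> Y'}, forall y, i' (a y) = i y.
  apply: factor_through_injective => // y; rewrite iE'.
  have : W (i y) by rewrite -iE; exists y.
  by rewrite -qE /preimage /ker /= => ->; exact: (submodule0 (submodule_range t)).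
have [b bE] : exists b : {linear Y' -> T}, forall y, t (b y) = (q \o i')%FUN y.
  apply: factor_through_injective => // y.
  by have : range i' (i' y) by [exists y]; rewrite iE'.
have se : short_exact a b.
  apply: short_exactI.
  - by move=> x y e; apply: ii; rewrite -!aE e.
  - move=> v; have [x xE] := sq (t v).
    have : (q @^-1` range t) x by exists v.
    by rewrite -iE' => -[y _ yE]; exists y; apply: ti; rewrite bE /= yE.
  - move=> y; apply: ti; rewrite bE /= aE linear0.
    by have : range i (i y) by [exists y]; rewrite iE -qE.
  - move=> y e; have : ker q (i' y) by rewrite /ker /= -[LHS]bE e linear0.
    by rewrite qE -iE => -[x _ xE]; exists x; apply: ii'; rewrite aE.
have GY' := finite_ddell_extension se GY (hT _ _ _ _ sq ti sT).
have E : range i' = W.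
  apply: Wmax; first by exists Y', i'.
  by rewrite -iE => _ [y _ <-]; exists (a y).
have [[v v0] _] := sT; exfalso; move/eqP: v0; apply.
have [_ sb _] := se; have [y <-] := sb v.
apply: ti; rewrite bE linear0 /=.
by have : range i' (i' y) by [exists y]; rewrite E -qE.
Qed.

(** The set whose infimum is [ddell k X]. *)
Definition ddell_set k X : set nat :=
  [set m | exists n : nat, (n <= m)%N /\
    exists (C : nat -> fgMod R) (d : forall i, {linear C i.+1 -> C i})
           (e : {linear C 0%N -> X}),
      exact_sequence n d e /\
      forall i, (i <= n)%N -> enat_le (dell (i + k) (C i)) (m - i)].

Lemma ddell_set_isomorphic k m X Y :
  isomorphic X Y -> ddell_set k X m -> ddell_set k Y m.
Proof.
case=> f /linear_inverse[g [fK gK]] [n [nm [C [d [e [[se re rd C0] h]]]]]].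
exists n; split=> //; exists C, d, (f \o e)%FUN; split=> //; split=> //.
  by move=> y; have [x xE] := se (g y); exists x; rewrite /= xE gK.
rewrite re; apply/seteqP; split=> c; rewrite /ker /=; first
  by move=> ->; rewrite linear0.
by rewrite -(linear0 f) => /(can_inj fK).
Qed.

(** Splices the short exact sequences into one resolution. Membership is proved for all large [m],
    so that the bound for [C] and the bound for the rest can be met by a common [m]. *)
Lemma finite_ddellP k X : finite_ddell k X ->
  exists m0, forall m, (m0 <= m)%N -> ddell_set k X m.
Proof.
elim=> {k X} [k X X0|k X C Y i p [ii sp e] /(finite_dellP hR)[n0 dC] _ [m0 IH]].
  have [n0 h] := finite_dellP hR (finite_dell_projective k (projective_zero X0)).
  exists n0 => m nm; exists 0%N; split=> //.
  exists (fun=> X), (fun=> \0), idfun; split; last first.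
    by move=> [|//] _; rewrite subn0; exact: enat_le_trans nm.
  have r0 : range (\0 : {linear X -> X}) = [set 0].
    by apply/seteqP; split=> [_ [x _ <-] //|_ ->]; exists 0.
  split=> [x||_|j _]; [by exists x| | |exact: X0].
    by rewrite r0; apply/seteqP; split=> x.
  by rewrite r0; apply/seteqP; split=> x _ //; exact: X0.
(* The resolution of [Y] is shifted by one position, where the permitted bound drops by one; hence
   the successor of [m0]. *)
exists (maxn n0 m0.+1) => -[|m]; rewrite geq_max => /andP[n0m m0m] //.
have [n [nm [C' [d [e' [[se re rd C0] h]]]]]] := IH m m0m.
exists n.+1; split=> //.
pose C'' j := if j is j'.+1 then C' j' else C.
pose d'' j : {linear C'' j.+1 -> C'' j} :=
  match j return {linear C'' j.+1 -> C'' j} with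
  | 0 => (i \o e')%FUN
  | j'.+1 => d j'
  end.
exists C'', d'', p; split; last first.
  case=> [|j] jn; first by rewrite subn0; exact: enat_le_trans n0m.
  (* Position [j.+1] for [k] is position [j] for [k.+1]. *)
  by rewrite addSnnS subSS; exact: h.
split=> //.
- rewrite -e; apply/seteqP; split=> _ [x _ <-]; first by exists (e' x).
  by have [y <-] := se x; exists y.
- case=> [|j]; last exact: rd.
  rewrite /= re; apply/seteqP; split=> c; rewrite /ker /=; first
  by move=> ->; rewrite linear0.
  by rewrite -(linear0 i) => /ii.
by case=> [|j] // jn; exact: C0.
Qed.

Lemma ddell_bound k m X : ddell_set k X m -> enat_le (ddell k X) m.
Proof. exact: enat_le_inf. Qed.

(* All quotients of P by the same submodule are isomorphic, so one bound
   serves them all. *)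
Lemma quotient_ddell_bound k P (W : set P) :
  exists m, forall X (p : {linear P -> X}), surjective p -> ker p = W ->
    finite_ddell k X -> enat_le (ddell k X) m.
Proof.
have [[X [p [sp pE GX]]]|h] := pselect (exists X (p : {linear P -> X}),
  [/\ surjective p, ker p = W & finite_ddell k X]); last first.
  by exists 0%N => X p sp pE GX; case: h; exists X, p.
have [m hm] := finite_ddellP GX; exists m => Y q sq qE _.
apply: ddell_bound; apply: ddell_set_isomorphic (hm m (leqnn _)).
by apply: isomorphic_quotients sp sq _; rewrite pE qE.
Qed.

End Extensions.

(** * One-point extensions of local algebras *)

Section OnePoint.
Variables (K : fieldType) (A : falgType K) (M : fgMod A).
Local Notation L := (one_point_extension M).
Implicit Types X Y Z S T : fgMod L.

(** The finite dimensional cover of [L] replaces [M] by tuples over [A], one entry per generator of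
    [M]. *)
Lemma one_point_finite_length : finite_length_ring L.
Proof.
have [s hs] := fgModP M.
pose V := (K^o * {ffun 'I_(size s) -> A} * A)%type.
have [sigma sE] : exists sigma : {linear V -> L}, forall v,
    sigma v = (v.1.1, \sum_i (v.1.2 i : A^c) *: s`_i, v.2).
  apply: linear_exists => c u v; congr (_, _, _) => /=.
  rewrite /one_point_lact scaler_sumr -big_split; apply: eq_bigr => i _.
  rewrite !ffunE scalerA -[RHS]scalerDl; congr ((_ + _) *: _).
  by rewrite -[RHS]/(u.1.2 i * c%:A : A) -scalerAr mulr1.
have ssurj : surjective sigma.
  move=> [[c m] a]; have [f fE] := hs m.
  exists (c, [ffun i => f i : A], a); rewrite sE /=; congr (_, _, _).
  by rewrite fE; apply: eq_bigr => i _; rewrite ffunE.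
move=> X; exact: (fin_dim_chain_conditions ssurj (fgModP X)).
Qed.

Lemma one_point_mulE (x y : L) : x * y =
  (x.1.1 * y.1.1, one_point_lact x.1.1 y.1.2 + one_point_ract x.1.2 y.2,
   x.2 * y.2).
Proof. by []. Qed.

Lemma one_point_lact0 (m : M) : one_point_lact 0 m = 0.
Proof. by rewrite /one_point_lact scale0r scale0r. Qed.
Lemma one_point_lactr0 (c : K) : one_point_lact c (0 : M) = 0.
Proof. exact: scaler0. Qed.
Lemma one_point_ract0 (a : A) : one_point_ract (0 : M) a = 0.
Proof. exact: scaler0. Qed.
Lemma one_point_ractr0 (m : M) : one_point_ract m (0 : A) = 0.
Proof. exact: scale0r. Qed.
Lemma one_point_lact1 (m : M) : one_point_lact 1 m = m.
Proof. by rewrite /one_point_lact scale1r; exact: scale1r. Qed.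

Local Notation simp := (one_point_mulE, one_point_lact0, one_point_lactr0,
  one_point_ract0, one_point_ractr0, one_point_lact1, mul0r, mulr0, mul1r,
  mulr1, addr0, add0r).

(** The idempotent of the new vertex; [one_point_inA 1] is the complementary idempotent. *)
Definition one_point_e0 : L := (1, 0, 0).
Definition one_point_inA (a : A) : L := (0, 0, a).
Local Notation e0 := one_point_e0.
Local Notation inA := one_point_inA.

Lemma one_point_decomp (r : L) : r = (r.1, 0) + inA r.2.
Proof.
by case: r => [[c m] a]; congr (_, _, _); rewrite /= ?addr0 ?add0r.
Qed.

Lemma one_point_scaleM (X : lmodType L^c) (r s : L) (x : X) :
  (s : L^c) *: ((r : L^c) *: x) = ((r * s : L) : L^c) *: x.
Proof. by rewrite scalerA. Qed.

(* Modules with [x e0 = 0] are exactly the A-modules. *)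
Definition A_module X : Prop := forall x : X, (e0 : L^c) *: x = 0.

Lemma A_module_sub X Y (i : {linear Y -> X}) :
  injective i -> A_module X -> A_module Y.
Proof. by move=> ii h y; apply: ii; rewrite linearZ_LR h linear0. Qed.

Lemma A_module_quotient X Y (p : {linear X -> Y}) :
  surjective p -> A_module X -> A_module Y.
Proof. by move=> sp h y; have [x <-] := sp y; rewrite -linearZ_LR h linear0. Qed.

(** The first row of [r] is a left multiple of [e0] in the product order [e0 * r'], so a right
    module killed by [e0] is killed by it. *)
Lemma A_module_scale X (x : X) (r : L) : A_module X ->
  (r : L^c) *: x = (inA r.2 : L^c) *: x.
Proof.
move=> h; have E : (r.1, 0) = e0 * (r.1, 0) :> L.
  by rewrite !simp; case: r => -[].
have z : ((r.1, 0) : L^c) *: x = 0.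
  by rewrite E -one_point_scaleM h scaler0.
by rewrite [in LHS](one_point_decomp r) scalerDl z add0r.
Qed.

Lemma inA0 : inA 0 = 0.
Proof. by []. Qed.

Lemma inA_add (a b : A) : inA (a + b) = inA a + inA b.
Proof. by congr (_, _, _); rewrite /= ?addr0. Qed.

(** * Simple modules as quotients of the regular module *)

Definition regular : fgMod L := FgMod (finitely_generated_free L 1).

Lemma regular_map X (x : X) : exists p : {linear regular -> X},
  forall v, p v = (v : 'rV_1) 0 0 *: x.
Proof. by apply: linear_exists => a u v; rewrite !mxE scalerDl scalerA. Qed.

Lemma simple_regular_surj S (x : S) (p : {linear regular -> S}) :
  simple_module S -> x != 0 -> (forall v, p v = (v : 'rV_1) 0 0 *: x) ->
  surjective p.
Proof.
move=> [_ sS] x0 pE y.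
have rx : range p x by exists (1 : 'rV_1) => //; rewrite pE mxE scale1r.
have [E|E] := sS _ (submodule_range p).
  by move: rx x0; rewrite E => /= ->; rewrite eqxx.
by have : range p y by [rewrite E]; case=> v _ <-; exists v.
Qed.

Lemma inA_mulr (a : A) (r : L) : inA a * r = inA (a * r.2).
Proof. by rewrite !simp. Qed.

(** For an ideal [J] above the annihilator [I], the submodule [x J] is zero or [S]. In the first
    case [J] lies in [I]; in the second, every [b] agrees on [x] with some [a] in [J], and [b - a]
    lies in [I]. *)
Lemma annihilator_maximal S (x : S) : simple_module S -> A_module S -> x != 0 ->
  maximal_right_ideal [set a : A | (inA a : L^c) *: x = 0].
Proof.
move=> [_ sS] AS x0; set I := [set a | _].
have Ix1 : (inA 1 : L^c) *: x = x.
  by rewrite -[RHS]scale1r [RHS]A_module_scale.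
split.
- split=> [|a b|a r] /=.
  + by rewrite /I /= inA0 scale0r.
  + by move=> ha hb; rewrite /I /= inA_add scalerDl ha hb addr0.
  + move=> ha; rewrite /I /= -[r]/((inA r).2) -inA_mulr -one_point_scaleM ha.
    by rewrite scaler0.
- move=> E; have : I 1 by rewrite E.
  by rewrite /I /= Ix1 => /eqP; rewrite (negPf x0).
move=> J [J0 JD JM] IJ.
have sW : submodule [set y : S | exists2 a, J a & y = (inA a : L^c) *: x].
  split; first by exists 0 => //; rewrite inA0 scale0r.
  move=> r _ _ [a Ja ->] [b Jb ->]; exists (a * (r : L).2 + b).
    by apply: JD => //; apply: JM.
  by rewrite one_point_scaleM inA_mulr inA_add scalerDl.
have [E|E] := sS _ sW; [left|right]; apply/seteqP; split=> // b.
  move=> Jb; have : [set 0 : S] ((inA b : L^c) *: x) by rewrite -E; exists b.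
  by [].
have : [set y : S | exists2 a, J a & y = (inA a : L^c) *: x] ((inA b : L^c) *: x).
  by rewrite E.
case=> a Ja ab _; rewrite -(subrK a b); apply: JD => //; apply: IJ.
rewrite /I /=; have := inA_add (b - a) a; rewrite subrK => iE.
by move: ab; rewrite iE scalerDl => /(canRL (addrK _)); rewrite subrr.
Qed.

Hypothesis hA : local_ring A.

(** The annihilator in [A] of a nonzero element is the unique maximal right ideal, whichever simple
    module is taken. *)
Lemma simple_A_module_kernel : exists W : set regular,
  forall S, simple_module S -> A_module S ->
  exists p : {linear regular -> S}, surjective p /\ ker p = W.
Proof.
have [I [_ Iuniq]] := hA.
exists [set v : regular | I ((v : 'rV[L^c]_1) 0 0 : L).2] => S sS AS.
have [[x x0] _] := sS; have [p pE] := regular_map x.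
exists p; split; first exact: simple_regular_surj sS x0 pE.
rewrite (Iuniq _ (annihilator_maximal sS AS x0)).
by apply/seteqP; split=> v; rewrite /ker /= pE (A_module_scale _ (v 0 0) AS).
Qed.

Lemma simple_A_modules_isomorphic S T : simple_module S -> A_module S ->
  simple_module T -> A_module T -> isomorphic S T.
Proof.
move=> sS AS sT AT; have [W h] := simple_A_module_kernel.
have [p [sp pE]] := h S sS AS; have [q [sq qE]] := h T sT AT.
by apply: isomorphic_quotients sp sq _; rewrite pE qE.
Qed.

(** The module is [inA 1 * L], a copy of [A], split off the regular module by left multiplication
    with the idempotent [inA 1]. *)
Lemma projective_A_module_exists :
  exists P : fgMod L, [/\ projective P, A_module P & exists x : P, x != 0].
Proof.
have [r rE] : exists r : {linear regular -> regular},
    forall v, r v = const_mx (inA 1 * ((v : 'rV[L^c]_1) 0 0 : L) : L^c).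
  apply: linear_exists => a u v; apply/matrixP => i j; rewrite !mxE.
  rewrite -[a * _ + _]/((u 0 0 : L) * (a : L) + (v 0 0 : L)) mulrDr mulrA.
  by [].
have [P [i [ii iE]]] := fg_submodule one_point_finite_length (submodule_range r).
have rr v : r (r v) = r v.
  rewrite !rE; apply/matrixP => ? ?; rewrite !mxE mulrA inA_mulr mul1r //.
have ri x : r (i x) = i x.
  by have : range i (i x) by [exists x]; rewrite iE => -[v _ <-].
have [q qE] : exists q : {linear regular -> P}, forall v, i (q v) = r v.
  by apply: factor_through_injective => // v; rewrite iE; exists v.
exists P; split.
- apply: (@projective_retract _ regular P i q); last exact: projective_free.
  by move=> x; apply: ii; rewrite qE ri.
- move=> x; apply: ii; rewrite linearZ_LR linear0 -ri rE.
  apply/matrixP => a b; rewrite !mxE.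
  rewrite -[LHS]/(inA 1 * ((i x : 'rV[L^c]_1) 0 0 : L) * e0) inA_mulr inA_mulr.
  by rewrite /= mulr0.
exists (q (1 : 'rV_1)); apply/eqP => /(congr1 i); rewrite qE rE linear0.
move=> /matrixP /(_ 0 0); rewrite !mxE /= => /(congr1 snd) /= /eqP.
by rewrite mulr1 oner_eq0.
Qed.

Lemma A_module_finite_ddell k X : A_module X -> finite_ddell k X.
Proof.
have hL := one_point_finite_length.
elim: k X => [|k IH] X AX; first exact: finite_ddell0.
apply: finite_ddell_composition => // Z T q t sq ti sT.
have AT : A_module T := A_module_sub ti (A_module_quotient sq AX).
have [P [pP AP nzP]] := projective_A_module_exists.
have [S [j [ji sS]]] := simple_submodule_exists hL nzP.
have AS : A_module S := A_module_sub ji AP.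
apply: finite_ddell_isomorphic (simple_A_modules_isomorphic sS AS sT AT) _.
(* The simple [S] is a syzygy of the quotient [Y] of [P] by [S], an A-module covered by the
   induction hypothesis. *)
have [Y [p [sp pE]]] := fg_quotient (submodule_range j).
apply: (finite_ddell_syzygy hL (IH Y (A_module_quotient sp AP))).
by exists P, j, p; split.
Qed.

(** The elements killed by [e0] form a submodule, hence zero here. If [r] has zero corner then
    [r * e0 = 0], so [r] kills [x]; a nonzero corner is invertible and would make [e0] kill [x]. *)
Lemma simple_not_A_module_kernel S : simple_module S -> ~ A_module S ->
  exists p : {linear regular -> S}, surjective p /\
    ker p = [set v | ((v : 'rV[L^c]_1) 0 0 : L).1.1 = 0].
Proof.
move=> sS nAS; have [[x x0] hS] := sS; have [p pE] := regular_map x.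
exists p; split; first exact: simple_regular_surj sS x0 pE.
have me0 (r : L) : r * e0 = e0 * (r.1.1, 0, 0).
  by rewrite !simp.
have sN : submodule [set y : S | (e0 : L^c) *: y = 0].
  split; first exact: scaler0.
  move=> r u v /= hu hv; rewrite scalerDr hv addr0 one_point_scaleM me0 -one_point_scaleM.
  by rewrite hu scaler0.
have N0 (y : S) : (e0 : L^c) *: y = 0 -> y = 0.
  have [E|E] := hS _ sN.
    by move=> hy; have : [set 0 : S] y by rewrite -E.
  case: nAS => z; have : [set y : S | (e0 : L^c) *: y = 0] z by rewrite E.
  by [].
have k0 (r : L) : r.1.1 = 0 -> (r : L^c) *: x = 0.
  move=> r0; apply: N0; rewrite one_point_scaleM me0 r0.
  have -> : e0 * (0, 0, 0) = 0 by rewrite !simp.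
  by rewrite scale0r.
apply/seteqP; split=> v; rewrite /ker /= pE; last exact: k0.
set r : L := v 0 0 => rx; apply/eqP; apply: contraT => c0.
suff x0' : x = 0 by move: x0; rewrite x0' eqxx.
have rE : r = (r.1.1, 0, 0) + (0, r.1.2, r.2).
  by case: r {rx c0} => [[c m] a]; congr (_, _, _); rewrite /= ?addr0 ?add0r.
have cx : ((r.1.1, 0, 0) : L^c) *: x = 0.
  move: rx; rewrite rE scalerDl => h; rewrite -{}h /=.
  by rewrite (k0 (0, r.1.2, r.2)) // addr0 !addr0.
apply: N0; have -> : e0 = ((r.1.1, 0, 0) : L) * ((r.1.1^-1, 0, 0) : L).
  by rewrite !simp /= divff.
by rewrite -one_point_scaleM cx scaler0.
Qed.

Lemma simple_not_A_module_finite_ddell k S :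
  simple_module S -> ~ A_module S -> finite_ddell k S.
Proof.
move=> sS nAS; have hL := one_point_finite_length.
have [p [sp pE]] := simple_not_A_module_kernel sS nAS.
have [Y [i [ii _ iE]]] := fg_kernel hL sp.
apply: (@FiniteDdellS _ _ _ regular Y i p).
- by [].
- by apply: finite_dell_projective; exact: projective_free.
(* The kernel consists of matrices with zero corner, and the corner is all that right multiplication
   by [e0] retains. *)
apply: A_module_finite_ddell => y; apply: ii; rewrite linear0 linearZ_LR.
have : range i (i y) by exists y.
rewrite iE pE /= => h; apply/matrixP => a b; rewrite !mxE.
rewrite -[LHS]/(((i y : 'rV[L^c]_1) a b : L) * e0) !ord1 one_point_mulE h.
by rewrite !simp.
Qed.

(** Every simple module is the quotient of the regular module by one of two fixed submodules, so the
    larger of two bounds serves all of them. *)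
Lemma one_point_ddell_finite k : enat_finite (ddell_ring k L).
Proof.
have hL := one_point_finite_length.
have [W hW] := simple_A_module_kernel.
have [m1 h1] := quotient_ddell_bound hL k W.
have [m2 h2] := quotient_ddell_bound hL k
  [set v : regular | ((v : 'rV[L^c]_1) 0 0 : L).1.1 = 0].
have : enat_le (ddell_ring k L) (maxn m1 m2).
  apply: enat_le_inf => _ [S sS ->].
  have [AS|nAS] := pselect (A_module S).
    have [p [sp pE]] := hW S sS AS.
    apply: enat_le_trans (leq_maxl _ _).
    exact: h1 sp pE (A_module_finite_ddell k AS).
  have [p [sp pE]] := simple_not_A_module_kernel sS nAS.
  apply: enat_le_trans (leq_maxr _ _).
  exact: h2 sp pE (simple_not_A_module_finite_ddell k sS nAS).
by case: (ddell_ring k L) => // n _; exists n.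
Qed.

End OnePoint.

Theorem corollary3p4 (K : fieldType) (A : falgType K) (M : fgMod A)
    (hA : local_ring A) (k : nat) (hk : (1 <= k)%N) :
  enat_finite (ddell_ring k (one_point_extension M)).
Proof. exact: one_point_ddell_finite. Qed.
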